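(* Let $k, m\ge 1$ be integers. There exists a congestion-free routing strategy in the directed graph $\mathcal{B}_{absolute}(k,m)$ that takes $2m-1$ hops in the worst-case and at most $1.5m$ hops on average, in which $\pi=1$.
   Context: The $n$ nodes lie on a ring and are labeled $0,1,\dots,n-1$ according to their order on the ring; $x \bmod n$ always denotes an element of $[0,n-1]$, even when $x$ is negative or greater than $n-1$. Graph $\mathcal{B}_{absolute}(k,m)$ (defined for integers $k,m\ge 1$): it has $n=(2k+1)^m m$ nodes. For a node $u$ let $\ell(u)=(m-1)-(u\bmod m)$. Each node has $2k+2$ out-going links: node $u$ makes $2k+1$ links with the nodes $(u+x)\bmod n$, where $x\in\{1+i m(2k+1)^{\ell(u)} : i\in[-k,+k]\}$ ($i$ an integer), and node $u$ also makes an out-going link with node $(u+x)\bmod n$, where $x=-m+1$. A routing strategy specifies how a message travels from a source node to a target node along directed links of the graph (it need not be greedy); the number of hops of a route is the number of links traversed. For a routing strategy, $\pi$ denotes the ratio of the maximum and minimum loads on edges caused by all $\binom{n}{2}$ pairwise routes; ''congestion-free'' refers to the property $\pi=1$.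
   Formalization: For m=1, the links that lead from a node back to itself (x = 0) are not counted as edges in the load ratio π, since no route of 2m-1 = 1 hop between distinct nodes can use them; for m≥2 there are no such links. *)

(* Defs.v *)
From mathcomp Require Import all_boot all_order all_algebra.

Set Implicit Arguments.
Unset Strict Implicit.
Unset Printing Implicit Defensive.

Import Order.TTheory GRing.Theory Num.Theory.
Local Open Scope ring_scope.

Definition num_nodes (k m : nat) : nat := ((2 * k).+1 ^ m * m)%N.

Fact ring_shift_subproof (n : nat) (u : 'I_n) (x : int) :
  (absz ((u%:Z + x) %% n%:Z)%Z < n)%N.
Proof.
have n_gt0 : 0 < n%:Z by rewrite ltz_nat (leq_ltn_trans _ (ltn_ord u)).
by rewrite -ltz_nat gez0_abs ?modz_ge0 ?gt_eqF //; apply: ltz_pmod.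
Qed.

(* The node (u + x) mod n of the ring; x may be negative. *)
Definition ring_shift (n : nat) (u : 'I_n) (x : int) : 'I_n :=
  Ordinal (ring_shift_subproof u x).

Section Babsolute.
Variables k m : nat.

Local Notation node := 'I_(num_nodes k m).

Definition level (u : node) : nat := (m.-1 - u %% m)%N.

(* The 2k+2 out-going links of a node: [Some i], with i ranging over 0 .. 2k,
   is the link of index i - k in [-k, k]; [None] is the additional link.
   Links are labelled, so the graph has parallel links: when level u = 0, the
   additional link has the same target as the link of index -1. *)
Definition label : Type := option 'I_(2 * k).+1.

Definition offset (u : node) (a : label) : int :=
  if a is Some i then
    1 + (i%:Z - k%:Z) * m%:Z * ((2 * k).+1 ^ level u)%N%:Z
  else - m%:Z + 1.

Definition link : Type := (node * label)%type.

Definition source (e : link) : node := e.1.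
Definition target (e : link) : node := ring_shift e.1 (offset e.1 e.2).

(* For m = 1 two of the links of each node lead back to the node itself; such
   self-loops connect no pair of nodes and are not counted as edges.  There is
   no self-loop when m > 1. *)
Definition is_edge (e : link) : bool := source e != target e.

(* The directed walks along links from u to v, as sequences of links. *)
Fixpoint is_route (u : node) (s : seq link) (v : node) : bool :=
  if s is e :: s' then (source e == u) && is_route (target e) s' v else u == v.

(* One route for each ordered pair of distinct nodes; the value of a strategy
   on the diagonal is irrelevant throughout. *)
Definition routing_strategy (R : node -> node -> seq link) : Prop :=
  forall u v : node, u != v -> is_route u (R u v) v.

Section Measures.
Variable R : node -> node -> seq link.

Definition worst_hops : nat :=
  (\max_(p : node * node | p.1 != p.2) size (R p.1 p.2))%N.

Definition avg_hops : rat :=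
  (\sum_(p : node * node | p.1 != p.2) size (R p.1 p.2))%N%:R /
  #|[set p : node * node | p.1 != p.2]|%:R.

Definition load (e : link) : nat :=
  (\sum_(p : node * node | p.1 != p.2) count_mem e (R p.1 p.2))%N.

Definition max_load : nat := (\max_(e : link | is_edge e) load e)%N.

(* A minimum over all edges: the initial value max_load does not affect it. *)
Definition min_load : nat :=
  \big[minn/max_load]_(e : link | is_edge e) load e.

(* The ratio is 0 when some edge carries no load. *)
Definition congestion : rat := max_load%:R / min_load%:R.

Definition congestion_free : Prop := congestion = 1.

End Measures.

End Babsolute.

(* Main.v *)
Require Import Defs.
From mathcomp Require Import all_boot all_order all_algebra.
From mathcomp Require Import zify ring.
Set Implicit Arguments.
Unset Strict Implicit.
Unset Printing Implicit Defensive.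
Import Order.TTheory GRing.Theory Num.Theory.
Local Open Scope ring_scope.

(** Put b = 2k+1.  The nodes form b^m rows of m columns (column = remainder
    modulo m), and every link leads to the next column.  As the levels of the
    m columns are distinct, m consecutive links with labels in [-k, k] move the
    row by a balanced base-b number, so a node reaches every node of its own
    column by exactly one such digit word.  A route from u to v with
    r = v - u mod m first makes r extra hops and then follows a digit word,
    which gives m + r hops; pairing u -> v with v -> u bounds the average by 3m/2.

    The labels of the r extra hops are chosen as a function of v and of the
    column of u only.  Then for fixed v the extra hops translate a column, so
    every label spreads its load evenly over the nodes of a column and the
    digit words are used once for each pair of nodes.  Hence all digit labels
    carry m^2 b^(m-1), and the labels of the extra hops may be distributed at
    will to level the total.

    What remains is divisibility: the total load per column must be a multiple
    of b+1.  It is adjusted by cutting a loop of m hops out of s routes per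
    row, where s is the remainder.  Only for k = 1 and m = 2, 3 is the common
    load too small for the m^2 b^(m-1) of the digit labels; there a few routes
    are modified by hand. *)

(** * Shifts on the ring *)

Section RingShift.
Variable n : nat.
Implicit Types (u v : 'I_n) (x y : int).

Lemma ord_gt0 u : (0 < n)%N.
Proof. exact: leq_ltn_trans (ltn_ord u). Qed.

Lemma ring_shiftE u x : (ring_shift u x)%:Z = ((u%:Z + x) %% n%:Z)%Z.
Proof.
by rewrite /= gez0_abs // modz_ge0 // eqz_nat -lt0n (ord_gt0 u).
Qed.

Lemma ring_shiftP u x v : reflect (u%:Z + x = v%:Z %[mod n])%Z (ring_shift u x == v).
Proof.
apply: (iffP eqP) => [<-|e]; first by rewrite ring_shiftE modz_mod.
apply/val_inj/eqP; rewrite -eqz_nat; apply/eqP; rewrite ring_shiftE e.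
by apply: modz_small; rewrite ltz_nat ltn_ord andbT.
Qed.

Lemma ring_shiftD u x y : ring_shift (ring_shift u x) y = ring_shift u (x + y).
Proof.
apply/eqP/ring_shiftP.
by rewrite !ring_shiftE modzDml modz_mod addrA.
Qed.

Lemma ring_shift0 u : ring_shift u 0 = u.
Proof. by apply/eqP/ring_shiftP; rewrite addr0. Qed.

Lemma ring_shift_bij x : bijective (fun u => ring_shift u x).
Proof.
by exists (fun u => ring_shift u (- x)) => u; rewrite ring_shiftD ?subrr ?addNr ring_shift0.
Qed.

Lemma ring_shift_sub u v : ring_shift u (v%:Z - u%:Z) = v.
Proof. by apply/eqP/ring_shiftP; rewrite addrC subrK. Qed.

End RingShift.

(** * Base-b numerals, most significant digit first *)

Section PositionalNotation.
Variable b : nat.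
Implicit Types (F G : nat -> nat) (q t : nat).
Local Open Scope nat_scope.

Definition value F q := \sum_(j < q) F j * b ^ (q - j.+1).

Lemma valueSr F q : value F q.+1 = value F q * b + F q.
Proof.
rewrite /value big_ord_recr /= subnn muln1 big_distrl /=; congr (_ + _).
by apply: eq_bigr => j _; rewrite -mulnA -expnSr subSS subnSK.
Qed.

Lemma value_lt F q : (forall j, j < q -> F j < b) -> value F q < b ^ q.
Proof.
elim: q => [|q IH] F_lt; first by rewrite /value big_ord0.
have /IH lt_q : forall j, j < q -> F j < b by move=> j lt_j; apply/F_lt/ltnW.
rewrite valueSr expnSr; apply: (@leq_trans ((value F q).+1 * b)).
  by rewrite mulSn addnC ltn_add2r F_lt.
by rewrite leq_mul2r lt_q orbT.
Qed.

Lemma value_inj F G q :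
    (forall j, j < q -> F j < b) -> (forall j, j < q -> G j < b) ->
  value F q = value G q -> forall j, j < q -> F j = G j.
Proof.
elim: q => // q IH F_lt G_lt; rewrite !valueSr => eq_FG.
have b_gt0 : 0 < b by apply: leq_ltn_trans (F_lt q _).
have Fq : F q < b by apply: F_lt.
have Gq : G q < b by apply: G_lt.
have eq_q : F q = G q.
  by move/(congr1 (modn^~ b)): eq_FG; rewrite !modnMDl !modn_small.
move: eq_FG; rewrite eq_q => /addIn/eqP; rewrite eqn_pmul2r // => /eqP eq_FG j.
rewrite ltnS leq_eqVlt => /predU1P[-> //|lt_j].
by apply: IH eq_FG _ lt_j => i lt_i; [apply/F_lt/ltnW|apply/G_lt/ltnW].
Qed.

Lemma value_digits t q : value (fun j => t %/ b ^ (q - j.+1) %% b) q = t %% b ^ q.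
Proof.
elim: q t => [|q IH] t; first by rewrite /value big_ord0 modn1.
rewrite valueSr subnn divn1.
have -> : value (fun j => t %/ b ^ (q.+1 - j.+1) %% b) q = t %/ b %% b ^ q.
  rewrite -IH; apply: eq_bigr => j _.
  by rewrite -divnMA -expnS subnSK.
rewrite modn_divl -expnSr -[X in _ + X](@modn_dvdm (b ^ q.+1)) ?expnS ?dvdn_mulr //.
by rewrite -divn_eq.
Qed.

End PositionalNotation.

(** * Distribution of labels with prescribed multiplicities *)

Section Allocation.
Variables T A : finType.
Implicit Types (D V : {set T}) (q : A -> nat).
Local Open Scope nat_scope.

(** List each [a] exactly [q a] times; the list is as long as [enum D], and [h] reads it at the
    position of x there. *)
Lemma allocation D q (a0 : A) : \sum_a q a = #|D| ->
  exists h : T -> A, forall a, #|[set x in D | h x == a]| = q a.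
Proof.
move=> sum_q; pose s := flatten [seq nseq (q a) a | a <- enum A].
have size_s : size s = #|D|.
  rewrite size_flatten /shape -map_comp (eq_map (g := q)) => [|a]; last exact: size_nseq.
  by rewrite sumnE big_map big_enum.
pose h x := nth a0 s (index x (enum D)); exists h => a.
have map_h : [seq h x | x <- enum D] = s.
  apply: (@eq_from_nth _ a0) => [|i]; rewrite size_map -cardE ?size_s // => lt_i.
  have [x0 _] : exists x, x \in D by apply/card_gt0P/(leq_ltn_trans _ lt_i).
  by rewrite (nth_map x0) -?cardE // /h index_uniq ?enum_uniq -?cardE.
rewrite -sum1dep_card -big_enum_cond /= sum1_count.
rewrite -(count_map h (pred1 a)) map_h count_flatten -map_comp sumnE big_map big_enum /=.
rewrite (bigD1 a) //= count_nseq /= eqxx mul1n big1 ?addn0 // => c /negbTE.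
by rewrite count_nseq /= => ->.
Qed.

(** Serve [V] first, lower the quota of [a0] by its size, and allocate the rest on [D :\: V]. *)
Lemma allocation_with V D q (a0 : A) :
    V \subset D -> #|V| <= q a0 -> \sum_a q a = #|D| ->
  exists h : T -> A,
    {in V, forall x, h x = a0} /\ forall a, #|[set x in D | h x == a]| = q a.
Proof.
move=> sVD leV sum_q; pose q' a := if a == a0 then q a - #|V| else q a.
have [|h card_h] := @allocation (D :\: V) q' a0.
  rewrite cardsD (setIidPr sVD) -sum_q (bigD1 a0) //= [in RHS](bigD1 a0) //= /q' eqxx.
  rewrite addnBAC //; congr (_ + _ - _).
  by apply: eq_bigr => a /negbTE->.
exists (fun x => if x \in V then a0 else h x); split=> [x ->//|a].
have -> : [set x in D | (if x \in V then a0 else h x) == a] =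
    [set x in D :\: V | h x == a] :|: (if a == a0 then V else set0).
  apply/setP => x; rewrite !inE [a == a0]eq_sym; case: ifP => [Vx|nVx].
    by rewrite (subsetP sVD) //= ; case: ifP; rewrite ?inE ?Vx.
  by case: ifP; rewrite ?inE ?nVx ?orbF //=.
rewrite cardsU card_h /q'; case: eqP => [->|_]; last by rewrite setI0 cards0 addn0 subn0.
rewrite (_ : _ :&: V = set0) ?cards0 ?subn0 ?subnK //.
by apply/setP => x; rewrite !inE; case: (x \in V); rewrite ?andbF.
Qed.
End Allocation.

(** * Words of labels, their walks and the columns they cross *)

Section Walks.
Variables k p : nat.
Local Notation b := (2 * k).+1.
Local Notation m := p.+1.
Local Notation n := (num_nodes k m).
Local Notation node := 'I_n.
Local Notation label := (label k).
Local Notation link := (link k m).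
Implicit Types (u v w : node) (c d : 'I_m) (a : label) (s t : seq label) (e : link).

Definition col u : 'I_m := inZp u.

(** The offset depends on the source only through its column, so a fixed word acts on a whole column
    as a translation. *)
Definition off c a : int :=
  if a is Some i then 1 + (i%:Z - k%:Z) * m%:Z * (b ^ (p - c))%N%:Z
  else - m%:Z + 1.

Lemma offsetE u a : offset u a = off (col u) a.
Proof. by []. Qed.

Fixpoint dest u s : node := if s is a :: s' then dest (target (u, a)) s' else u.

Fixpoint walk u s : seq link :=
  if s is a :: s' then (u, a) :: walk (target (u, a)) s' else [::].

Lemma walk_route u s : is_route u (walk u s) (dest u s).
Proof. by elim: s u => [|a s IH] u /=; rewrite eqxx ?IH. Qed.

Lemma size_walk u s : size (walk u s) = size s.
Proof. by elim: s u => [|a s IH] u //=; rewrite IH. Qed.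

Lemma dest_cat u s t : dest u (s ++ t) = dest (dest u s) t.
Proof. by elim: s u => //= a s IH u. Qed.

Lemma walk_cat u s t : walk u (s ++ t) = walk u s ++ walk (dest u s) t.
Proof. by elim: s u => //= a s IH u; rewrite IH. Qed.

Lemma inZpD i j : inZp (i + j) = inZp i + inZp j :> 'I_m.
Proof. by apply: val_inj; rewrite /= modnDm. Qed.

Lemma inZp0 : inZp 0 = 0 :> 'I_m.
Proof. by apply: val_inj; rewrite /= mod0n. Qed.

Lemma addc0 c : c + inZp 0 = c.
Proof. by rewrite inZp0 addr0. Qed.

Lemma inZp_val c : inZp c = c.
Proof. by apply: val_inj; rewrite /= modn_small. Qed.

Lemma col_eqmod u v : (col u == col v) = (u%:Z == v%:Z %[mod m])%Z.
Proof. by rewrite -val_eqE /= !modz_nat eqz_nat. Qed.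

Lemma ring_shift_eqmod u x q : (q %| n)%N -> ((ring_shift u x)%:Z = u%:Z + x %[mod q])%Z.
Proof.
move=> /dvdnP[r def_n]; rewrite ring_shiftE; move: (u%:Z + x) => y.
by rewrite {2}(divz_eq y n%:Z) def_n PoszM mulrA modzMDl.
Qed.

Lemma dvdn_m : (m %| n)%N. Proof. exact: dvdn_mull. Qed.

Lemma col_shift u c a : col (ring_shift u (off c a)) = col u + inZp 1.
Proof.
apply/val_inj/eqP; rewrite -eqz_nat /= modnDm -!modz_nat; apply/eqP.
rewrite ring_shift_eqmod ?dvdn_m // PoszD.
rewrite /off; case: a => [i|].
  rewrite -[X in X = _](modzMDl (- ((i%:Z - k%:Z) * (b ^ (p - c))%N%:Z))).
  by congr (_ %% _)%Z; ring.
by rewrite -[X in X = _](modzMDl 1); congr (_ %% _)%Z; ring.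
Qed.

Lemma col_target u a : col (target (u, a)) = col u + inZp 1.
Proof. by rewrite /target offsetE col_shift. Qed.

Lemma sum_target c a (F : node -> nat) :
  (\sum_(u | col u == c) F (target (u, a)) = \sum_(u | col u == (c + inZp 1)%R) F u)%N.
Proof.
rewrite [RHS](reindex (fun u => ring_shift u (off c a))) /=; last exact/onW_bij/ring_shift_bij.
apply: eq_big => [u|u /eqP <- //].
by rewrite col_shift (inj_eq (addIr _)).
Qed.

Lemma col_dest u s : col (dest u s) = col u + inZp (size s).
Proof.
elim: s u => [|a s IH] u /=.
  by rewrite addc0.
by rewrite IH col_target -addrA -inZpD.
Qed.

Lemma sum_dest c s (F : node -> nat) :
  (\sum_(u | col u == c) F (dest u s) = \sum_(u | col u == (c + inZp (size s))%R) F u)%N.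
Proof.
elim: s c => [|a s IH] c /=.
  by rewrite addc0.
by rewrite (sum_target c a (fun u => F (dest u s))) IH -addrA -inZpD.
Qed.

Fixpoint visits c s d a : nat :=
  if s is x :: s' then ((c == d) && (x == a) + visits (c + inZp 1)%R s' d a)%N else 0.

(** Every prefix of the word translates column c onto another column, so each node there is passed
    once per visit. *)
Lemma sum_walk c s e :
  (\sum_(u | col u == c) count_mem e (walk u s) = visits c s (col e.1) e.2)%N.
Proof.
elim: s c => [|x s IH] c /=; first by rewrite big1.
rewrite big_split /= (sum_target c x (fun u => count_mem e (walk u s))) IH; congr addn.
case: e {IH} => u a /=.
have [<-|ne] := eqVneq (col u) c; last first.
  rewrite big1 // => w /eqP cw; rewrite xpair_eqE; case: eqP => //= wu.
  by rewrite -cw wu eqxx in ne.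
rewrite (bigD1 u) //= xpair_eqE eqxx big1 ?addn0 // => w /andP[_ /negbTE].
by rewrite xpair_eqE => ->.
Qed.

Fixpoint disp c s : int :=
  if s is a :: s' then off c a + disp (c + inZp 1) s' else 0.

Lemma dest_shift u s : dest u s = ring_shift u (disp (col u) s).
Proof.
elim: s u => [|a s IH] u /=; first by rewrite ring_shift0.
by rewrite IH col_target ring_shiftD.
Qed.

Definition colword (h : 'I_m -> label) c l : seq label :=
  mkseq (fun j => h (c + inZp j)) l.

Lemma size_colword h c l : size (colword h c l) = l.
Proof. exact: size_mkseq. Qed.


Lemma colwordS h c l : colword h c l.+1 = h c :: colword h (c + inZp 1) l.
Proof.
rewrite /colword /mkseq /= addc0; congr cons.
rewrite -[1%N]addn0 iotaDl -map_comp; apply: eq_map => j /=.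
by rewrite -addrA -inZpD.
Qed.

Lemma colwordSr h c l : colword h c l.+1 = rcons (colword h c l) (h (c + inZp l)).
Proof. by rewrite /colword mkseqS. Qed.

Lemma val_subc1 c : c - inZp 1 = (if c == inZp 0 then p else c.-1) :> nat.
Proof.
have -> : c - inZp 1 = c + inZp p.
  congr (_ + _); apply/eqP; rewrite eq_sym -addr_eq0 -inZpD addn1.
  by apply/eqP/val_inj; rewrite /= modnn.
have -> : c == inZp 0 = (nat_of_ord c == 0)%N by rewrite -val_eqE /= mod0n.
case: c => -[|c] lt_c /=; first by rewrite add0n !modn_small.
by rewrite modnDmr addSnnS modnDr modn_small // ltnW.
Qed.

(** At most m letters meet each column at most once, and column d is met at position d - c. *)
Lemma visits_colword h c l d a : (l <= m)%N ->
  visits c (colword h c l) d a = (((d - c)%R < l)%N && (h d == a)) :> nat.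
Proof.
elim: l c => [|l IH] c lt_l; first by rewrite ltn0.
rewrite colwordS [visits _ _ _ _]/= IH ?(ltnW lt_l) // opprD addrA val_subc1.
have -> : (d - c == inZp 0) = (c == d).
  by rewrite inZp0 subr_eq0 eq_sym.
case: eqVneq => [->|ne_cd].
  by rewrite subrr ltn0Sn ltnNge -ltnS lt_l addn0.
rewrite add0n; case def_j: (nat_of_ord (d - c)) => [|j] //.
case/eqP: ne_cd; apply/esym/subr0_eq/val_inj; exact: def_j.
Qed.

Lemma disp_colword h c : disp c (colword h c m) = \sum_d off d (h d).
Proof.
have disp_sum l c0 : disp c0 (colword h c0 l) = \sum_(j < l) off (c0 + inZp j) (h (c0 + inZp j)).
  elim: l c0 => [|l IH] c0; first by rewrite big_ord0.
  rewrite colwordS big_ord_recl /= IH addc0; congr (_ + _).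
  by apply: eq_bigr => j _; rewrite -addrA -inZpD.
rewrite disp_sum [RHS](reindex (fun j => c + j)) /=.
  by apply: eq_bigr => j _; rewrite inZp_val.
by exists (fun j => j - c) => j _; [rewrite addrC addKr | rewrite addrC subrK].
Qed.

(** * Digit words and the nodes of a column *)

Local Notation digits := {ffun 'I_m -> 'I_b}.
Implicit Types g : digits.

(** The label [Some i] stands for the digit i - k; [dval] is the value of the
    unshifted digits, the digit of column 0 being the most significant one. *)
Definition dval g : nat := value b (fun j => g (inZp j)) m.

Definition digit_word g c := colword (fun d => Some (g d)) c m.

Definition offset_val : nat := value b (fun=> k) m.

Lemma dval_lt g : (dval g < b ^ m)%N.
Proof. exact/value_lt. Qed.

Lemma dval_inj : injective dval.
Proof.
move=> g g' eq_g; apply/ffunP => d; apply: val_inj.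
have := value_inj (fun j _ => ltn_ord (g (inZp j))) (fun j _ => ltn_ord (g' (inZp j)))
  eq_g (ltn_ord d).
by rewrite !inZp_val.
Qed.

Lemma dval_surj x : (x < b ^ m)%N -> exists g, dval g = x.
Proof.
move=> lt_x; exists [ffun d => inord (x %/ b ^ (p - nat_of_ord d) %% b)].
rewrite -[RHS](modn_small lt_x) -value_digits /dval /value.
apply: eq_bigr => j _; rewrite ffunE inordK ?ltn_mod //.
by rewrite inZp_val.
Qed.

(** The unit steps of the m offsets add up to m, whence the 1; the digits contribute m times a
    balanced numeral. *)
Lemma dest_digit_word u g :
  dest u (digit_word g (col u)) =
    ring_shift u (m%:Z * (1 + (dval g)%:Z - offset_val%:Z)).
Proof.
rewrite dest_shift disp_colword; congr ring_shift.
rewrite /dval /offset_val /value !(big_morph Posz PoszD (erefl _)).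
rewrite -addrA -sumrB mulrDr mulr1 mulr_sumr.
have sum1 : \sum_(d < m) 1 = m%:Z by rewrite sumr_const card_ord natz.
rewrite -[X in _ = X + _]sum1 -big_split /=; apply: eq_bigr => d _.
by rewrite inZp_val subSS !PoszM /off; ring.
Qed.

Lemma col_digit_word u g : col (dest u (digit_word g (col u))) = col u.
Proof.
rewrite col_dest size_colword; have -> : inZp m = 0 :> 'I_m; last by rewrite addr0.
by apply: val_inj; rewrite /= modnn.
Qed.

Lemma ring_shift_mul_eq u (x y : int) :
  (ring_shift u (m%:Z * x) == ring_shift u (m%:Z * y)) =
    (x == y %[mod (b ^ m)%N])%Z.
Proof.
have -> : (x == y %[mod (b ^ m)%N])%Z = (u%:Z + m%:Z * x == u%:Z + m%:Z * y %[mod n])%Z.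
  rewrite !eqz_mod_dvd opprD addrACA subrr add0r -mulrBr /num_nodes [(_ * m)%N]mulnC.
  by rewrite PoszM dvdz_mul2l.
by apply/ring_shiftP/eqP; rewrite ring_shiftE modz_mod.
Qed.

Lemma digit_word_inj u g g' :
  dest u (digit_word g (col u)) = dest u (digit_word g' (col u)) -> g = g'.
Proof.
rewrite !dest_digit_word => /eqP; rewrite ring_shift_mul_eq eqz_modDr eqz_modDl.
by rewrite !modz_small ?ltz_nat ?dval_lt // => /eqP[/dval_inj].
Qed.

Lemma digit_word_ex u v : col u = col v -> exists g, dest u (digit_word g (col u)) = v.
Proof.
move/eqP; rewrite eq_sym col_eqmod eqz_mod_dvd => /dvdzP[x def_x].
have B_gt0 : 0 < (b ^ m)%N%:Z by rewrite ltz_nat expn_gt0.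
(* Solves 1 + y - [offset_val] = x modulo b^m. *)
pose y := ((x - 1 + offset_val%:Z) %% (b ^ m)%N%:Z)%Z.
have y_ge0 : 0 <= y by rewrite modz_ge0 // gt_eqF.
have [|g def_g] := @dval_surj `|y|%N.
  by rewrite -ltz_nat gez0_abs // ltz_pmod.
exists g; rewrite dest_digit_word def_g gez0_abs // -[RHS](ring_shift_sub u) def_x mulrC.
apply/eqP; rewrite ![_ * m%:Z]mulrC ring_shift_mul_eq; apply/eqP.
have -> : 1 + y - offset_val%:Z = y + (1 - offset_val%:Z) by ring.
by rewrite modzDml; congr (_ %% _)%Z; ring.
Qed.

(** The default occurs only when u and v lie in different columns. *)
Definition dig u v : digits :=
  odflt [ffun=> ord0] [pick g | dest u (digit_word g (col u)) == v].

Lemma digK u v : col u = col v -> dest u (digit_word (dig u v) (col u)) = v.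
Proof.
rewrite /dig => /digit_word_ex[g def_v]; case: pickP => [g' /eqP //|/(_ g)].
by rewrite def_v eqxx.
Qed.

Lemma dest_dig u g : dig u (dest u (digit_word g (col u))) = g.
Proof. by apply: (@digit_word_inj u); rewrite digK // col_digit_word. Qed.

Lemma sum_col_dig u (F : node -> nat) :
  (\sum_(v | col v == col u) F v = \sum_g F (dest u (digit_word g (col u))))%N.
Proof.
rewrite (reindex_onto (fun g => dest u (digit_word g (col u))) (dig u)) /=.
  by apply: eq_bigl => g; rewrite col_digit_word dest_dig !eqxx.
by move=> v /eqP cv; apply/digK.
Qed.

Lemma card_digits : #|{: digits}| = (b ^ m)%N.
Proof. by rewrite card_ffun !card_ord. Qed.

Lemma card_digit_eq d (i : 'I_b) : #|[pred g : digits | g d == i]| = (b ^ p)%N.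
Proof.
pose A (x : 'I_m) : pred 'I_b := if x == d then pred1 i else predT.
transitivity #|family A|.
  apply: eq_card => g; rewrite inE /=; apply/eqP/familyP => [gd x|/(_ d)].
    by rewrite /A; case: eqP => [->|]; rewrite inE ?gd ?eqxx.
  by rewrite /A eqxx inE => /eqP.
rewrite card_family foldrE big_map big_enum /= (bigD1 d) //= /A eqxx card1 mul1n.
rewrite (eq_bigr (fun=> b)) => [|x /negbTE->]; last exact: card_ord.
by rewrite prod_nat_const cardC1 card_ord.
Qed.

Lemma num_nodes_gt0 : (0 < n)%N. Proof. by rewrite muln_gt0 expn_gt0. Qed.

Lemma col_ex c : exists u, col u = c.
Proof.
have lt_c : (c < n)%N by rewrite (leq_trans (ltn_ord c)) // leq_pmull ?expn_gt0.
by exists (Ordinal lt_c); apply: inZp_val.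
Qed.

Lemma card_col c : #|[pred v | col v == c]| = (b ^ m)%N.
Proof.
have [u <-] := col_ex c; rewrite -sum1_card (eq_bigl (fun v => col v == col u)) //.
by rewrite sum_col_dig sum1_card card_digits.
Qed.

(** Reduces the theorem to hop bounds and a constant load. As diagonal words are empty, sums over
    all pairs equal sums over distinct pairs. *)
Lemma balanced_routing (W : node -> node -> seq label) (L : nat) :
    (0 < L)%N -> (forall u v, dest u (W u v) = v) -> (forall u, W u u = [::]) ->
    (forall u v, size (W u v) <= m + (col v - col u)%R)%N ->
    (exists u v, size (W u v) = m + p)%N ->
    (forall e, is_edge e -> \sum_u \sum_v count_mem e (walk u (W u v)) = L)%N ->
    (exists e : link, is_edge e) ->
  exists R : node -> node -> seq link,
    [/\ routing_strategy R,
        worst_hops R = (2 * m - 1)%N,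
        avg_hops R <= 3%:R / 2%:R * m%:R
      & congestion_free R].
Proof.
move=> L_gt0 destW W0 sizeW [u0 [v0 size0]] loadW [e0 edge0].
have ne0 : u0 != v0 by apply/eqP => e; move: size0; rewrite e W0.
pose R u v := walk u (W u v); exists R.
have loadR e : is_edge e -> load R e = L.
  move=> /loadW <-; rewrite pair_big /= /load big_mkcond /=; apply: eq_bigr => -[u v] _ /=.
  by case: eqVneq => //= ->; rewrite W0.
split.
- by move=> u v _; rewrite -[X in is_route _ _ X](destW u v); apply: walk_route.
- apply/eqP; rewrite eqn_leq /worst_hops; apply/andP; split.
    apply/bigmax_leqP => -[u v] _ /=; rewrite size_walk (leq_trans (sizeW u v)) //.
    by have := ltn_ord (col v - col u); lia.
  apply: leq_trans (leq_bigmax_cond (u0, v0) ne0); rewrite /= size_walk size0; lia.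
- rewrite /avg_hops ler_pdivrMr; last first.
    by rewrite ltr0n card_gt0; apply/set0Pn; exists (u0, v0); rewrite inE.
  set S := (\sum_(_ | _) _)%N; set N := #|_|.
  have S_swap : S = (\sum_(x : node * node | x.1 != x.2) size (R x.2 x.1))%N.
    by rewrite /S (reindex_inj (inv_inj swap_pairK)); apply: eq_bigl => -[u v]; rewrite eq_sym.
  suff : (S + S <= N * (3 * m))%N.
    rewrite -(ler_nat rat) natrM !natrD natrM => leSN.
    rewrite -(@ler_pM2r _ 2%:R) // mulr_natr mulr2n (le_trans leSN) //.
    by rewrite le_eqVlt; apply/orP; left; apply/eqP; field.
  rewrite {2}S_swap -big_split /= /N -sum_nat_const [leqRHS](eq_bigl (fun x => x.1 != x.2)).
    apply: leq_sum => -[u v] _ /=; rewrite !size_walk.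
    apply: leq_trans (leq_add (sizeW u v) (sizeW v u)) _.
    (* Opposite column gaps add up to m, or to 0 inside a column, so two opposite routes take at
       most 3m hops. *)
    have : ((col v - col u)%R + (- (col v - col u))%R <= m)%N.
      move: (col v - col u) => x; rewrite /= -leq_subRL ?leq_mod //.
      exact: ltnW (ltn_ord x).
    rewrite opprB; move: (nat_of_ord _) (nat_of_ord _) => x y; lia.
  by move=> x; rewrite inE.
- have max_L : max_load R = L.
    apply/eqP; rewrite eqn_leq; apply/andP; split.
      by apply/bigmax_leqP => e /loadR ->.
    by rewrite -(loadR _ edge0); apply: leq_bigmax_cond edge0.
  have min_L : min_load R = L.
    rewrite /min_load max_L; apply: (big_ind (fun x => x = L)) => // x y -> ->; exact: minnn.
  by rewrite /congestion_free /congestion max_L min_L divff // pnatr_eq0 -lt0n.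
Qed.

Lemma sum_by_col (F : 'I_m -> node -> nat) :
  (\sum_u F (col u) u = \sum_c \sum_(u | col u == c) F c u)%N.
Proof.
rewrite (partition_big col predT) //=; apply: eq_bigr => c _.
by apply: eq_bigr => u /eqP ->.
Qed.

(** * Full routes: extra hops followed by a digit word *)

Section FullRoutes.
Variable f : 'I_m -> 'I_m -> node -> label.

(** [f d c v] is the label used in column [d] by the extra hops of the routes
    from column [c] to [v]. *)
Definition slot_word c v := colword (fun d => f d c v) c (col v - c)%R.

Definition full u v :=
  let w := dest u (slot_word (col u) v) in
  slot_word (col u) v ++ digit_word (dig w v) (col w).

Lemma col_slot_word u v : col (dest u (slot_word (col u) v)) = col v.
Proof. by rewrite col_dest size_colword inZp_val addrC subrK. Qed.

Lemma dest_full u v : dest u (full u v) = v.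
Proof. by rewrite dest_cat digK // col_slot_word. Qed.

Lemma size_full u v : size (full u v) = (m + (col v - col u)%R)%N.
Proof. by rewrite size_cat !size_colword addnC. Qed.

(** A digit word meets column d once, whatever its start, and b^p of them have a given digit
    there. *)
Lemma sum_digit_word d a :
  (\sum_(g : digits) \sum_c visits c (digit_word g c) d a =
     if a is Some _ then m * b ^ p else 0)%N.
Proof.
rewrite exchange_big (eq_bigr (fun=> if a is Some _ then b ^ p else 0)%N) => [|c _].
  by rewrite sum_nat_const card_ord; case: a => //; rewrite muln0.
rewrite (eq_bigr (fun g : digits => (Some (g d) == a) : nat)) => [|g _]; last first.
  by rewrite [visits _ _ _ _]visits_colword // ltn_ord.
case: a => [i|]; last by rewrite big1.
rewrite -(card_digit_eq d i) -sum1_card [RHS]big_mkcond; apply: eq_bigr => g _ /=.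
rewrite inE; case: eqP => [[->]|ne]; first by rewrite eqxx.
by case: eqP => // gd; case: ne; rewrite gd.
Qed.

(** For fixed c and v the extra hops map column c bijectively onto that of v, so each pair inside a
    column is joined by its digit word once for every c; hence the factor m. *)
Lemma sum_full e :
  (\sum_u \sum_v count_mem e (walk u (full u v)) =
     \sum_c \sum_v (((col e.1 - c)%R < (col v - c)%R) && (f (col e.1) c v == e.2)) +
     m * (if e.2 is Some _ then m * b ^ p else 0))%N.
Proof.
rewrite (eq_bigr (fun u => \sum_v count_mem e (walk u (slot_word (col u) v)) +
   \sum_v let w := dest u (slot_word (col u) v) in
          count_mem e (walk w (digit_word (dig w v) (col w))))%N) => [|u _]; last first.
  by rewrite -big_split; apply: eq_bigr => v _; rewrite walk_cat count_cat.
rewrite big_split /=; congr addn.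
  rewrite (sum_by_col (fun c u => \sum_v count_mem e (walk u (slot_word c v)))%N).
  apply: eq_bigr => c _; rewrite exchange_big; apply: eq_bigr => v _.
  by rewrite sum_walk [visits _ _ _ _]visits_colword // ltnW.
pose G v w := count_mem e (walk w (digit_word (dig w v) (col w))).
rewrite (sum_by_col (fun c u => \sum_v G v (dest u (slot_word c v)))%N).
rewrite (eq_bigr (fun=> \sum_w \sum_(v | col v == col w) G v w)%N) => [|c _]; last first.
  rewrite exchange_big /= [RHS](exchange_big_dep predT) //=.
  apply: eq_bigr => v _. rewrite (sum_dest c (slot_word c v) (G v)) size_colword.
  by rewrite inZp_val addrC subrK; apply: eq_bigl => w; rewrite eq_sym.
rewrite sum_nat_const card_ord; congr muln; rewrite -(sum_digit_word (col e.1)).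
rewrite (eq_bigr (fun w => \sum_g count_mem e (walk w (digit_word g (col w))))%N) => [|w _].
  rewrite (sum_by_col (fun c w => \sum_g count_mem e (walk w (digit_word g c)))%N).
  rewrite exchange_big; apply: eq_bigr => c _; rewrite exchange_big.
  by apply: eq_bigr => g _; rewrite sum_walk.
by rewrite sum_col_dig; apply: eq_bigr => g _; rewrite /G dest_dig.
Qed.
End FullRoutes.

Hypothesis k_gt0 : (0 < k)%N.

Lemma dval_top g : (dval g %/ b ^ p)%N = g 0.
Proof.
rewrite /dval /value big_ord_recl /= subSS subn0 divnMDl ?expn_gt0 //.
rewrite divn_small ?addn0 ?inZp0 //.
exact: (@value_lt b (fun j => g (inZp j.+1)) p).
Qed.

Definition zero_digit : 'I_b := inord k.

Lemma zero_digitE : zero_digit = k :> nat.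
Proof. by rewrite inordK //; lia. Qed.

Lemma off_zero d : off d (Some zero_digit) = 1.
Proof. by rewrite /off zero_digitE subrr !mul0r addr0. Qed.

(** With [off ord_max a = 1 - m], the word [still a] goes once around the columns
    and returns to its source. *)
Definition still (a : label) d : label := if d == ord_max then a else Some zero_digit.

Lemma dest_still a u : off ord_max a = 1 - m%:Z -> dest u (colword (still a) (col u) m) = u.
Proof.
move=> off_a; rewrite dest_shift disp_colword big_ord_recr /= /still eqxx off_a.
rewrite (eq_bigr (fun=> 1)) => [|d _].
  rewrite sumr_const card_ord natz -[RHS]ring_shift0; congr ring_shift; lia.
by rewrite -val_eqE /= ltn_eqF // off_zero.
Qed.

(** The digit -1; in the last column, of level 0, its offset is that of [None]. *)
Definition down_digit : 'I_b := inord k.-1.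

Definition idle_digits : digits := [ffun d => if d == ord_max then down_digit else zero_digit].

Lemma idle_digitsE d : Some (idle_digits d) = still (Some down_digit) d.
Proof. by rewrite ffunE /still; case: ifP. Qed.

Lemma off_down : off ord_max (Some down_digit) = 1 - m%:Z.
Proof.
rewrite /off inordK; last lia.
by rewrite subnn expn0 mulr1 -subn1 -subzn // addrAC subrr add0r mulN1r.
Qed.

Lemma off_none : off ord_max None = 1 - m%:Z.
Proof. by rewrite /off addrC. Qed.

Lemma dig_idle u : dig u u = idle_digits.
Proof.
apply: (@digit_word_inj u); rewrite digK // -[LHS](dest_still u off_down).
by congr dest; apply: eq_map => j; rewrite idle_digitsE.
Qed.

(** * Cutting loops of m hops out of routes *)

Section Shortcuts.
Variables (s : nat) (f : 'I_m -> 'I_m -> node -> label).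

(** A route from column 1 to a special node starts with the extra hops of
    [still None]; when its digit word continues with a zero digit it is back at
    its source after m hops, and this loop can be cut.  The targets for which
    that happens occupy b^p consecutive rows, hence exactly [s] are special. *)
Definition special v := (col v == 0) && ((v %/ m) %% b ^ p < s)%N.

Hypothesis s_gt0 : (0 < s -> 0 < p)%N.
Hypothesis s_le : (s <= b ^ p)%N.
Hypothesis f_special : forall v d, special v -> d != 0 -> f d (inZp 1) v = still None d.

(** For u in column 1 these p hops end in column 0, where the digit word towards a special target
    begins. *)
Definition anchor u := dest u (colword (still None) (col u) p).

Definition short u v :=
  [&& special v, col u == inZp 1 & dig (anchor u) v 0 == zero_digit].

(** [behead] removes the zero digit read in column 0, the last hop of the loop that is cut. *)
Definition shortcut u v : seq label :=
  if u == v then [::]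
  else if short u v then behead (digit_word (dig (anchor u) v) 0) else full f u v.

Definition loop u v : seq label :=
  if u == v then colword (still (Some down_digit)) (col u) m
  else if short u v then colword (still None) (col u) m else [::].

Lemma special_gt0 v : special v -> (0 < p)%N.
Proof. by case/andP=> _ /(leq_trans _) lt_s; apply/s_gt0/lt_s. Qed.

(** The loop is a prefix that returns to its source, so cutting it leaves a route and its load can
    be counted apart. *)
Lemma full_shortcut u v : full f u v = loop u v ++ shortcut u v.
Proof.
rewrite /loop /shortcut; case: (eqVneq u v) => [<-|_].
  rewrite cats0 /full /slot_word subrr /= dig_idle.
  by apply: eq_map => j; rewrite idle_digitsE.
case: ifP => // /and3P[spec_v /eqP col_u /eqP dig0]; have p_gt0 := special_gt0 spec_v.
have /andP[/eqP col_v _] := spec_v.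
have slotE : slot_word f (col u) v = colword (still None) (col u) p.
  rewrite /slot_word col_v col_u val_subc1 inZp0 eqxx.
  apply/eq_in_map => j; rewrite mem_iota add0n => /= lt_j.
  by rewrite f_special // -inZpD -val_eqE /= modn_small.
have col_anchor : col (anchor u) = 0.
  by rewrite /anchor -slotE col_slot_word.
rewrite /full slotE -/(anchor u) col_anchor /digit_word colwordS dig0 -cat_rcons colwordSr /behead.
congr (rcons _ _ ++ _); rewrite col_u -inZpD add1n /still -val_eqE /= modnn.
by case: p p_gt0.
Qed.

Lemma dest_loop u v : dest u (loop u v) = u.
Proof.
rewrite /loop; case: ifP => _; first exact/dest_still/off_down.
by case: ifP => // _; apply/dest_still/off_none.
Qed.

Lemma dest_shortcut u v : dest u (shortcut u v) = v.
Proof. by rewrite -[RHS](dest_full f u) full_shortcut dest_cat dest_loop. Qed.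

Lemma size_shortcut u v : (size (shortcut u v) <= m + (col v - col u)%R)%N.
Proof. by rewrite -(size_full f) full_shortcut size_cat leq_addl. Qed.

(** The b^p digit words with zero digit in column 0 reach rows distinct modulo b^p, so every residue
    occurs once and s of them are below s. *)
Lemma card_short u : col u = inZp 1 -> (0 < p)%N -> #|[pred v | short u v]| = s.
Proof.
move=> col_u p_gt0; set w := anchor u.
have col_w : col w = 0.
  rewrite col_dest size_colword col_u -inZpD add1n.
  by apply: val_inj; rewrite /= modnn.
pose N := (b ^ p)%N.
have N_gt0 : (0 < N)%N by rewrite expn_gt0.
pose psi (g : digits) : 'I_N := Ordinal (ltn_pmod (dest w (digit_word g (col w)) %/ m) N_gt0).
pose T := [pred g : digits | g 0 == zero_digit].
have psi_inj : {in T &, injective psi}.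
  move=> g g' /eqP g0 /eqP g'0 eq_psi; apply: dval_inj.
  (* The leading digit is fixed, so it remains to compare [dval] modulo N, which the column and the
     row of the end node determine. *)
  rewrite (divn_eq (dval g) N) (divn_eq (dval g') N) !dval_top g0 g'0; congr addn.
  have Nm_n : (N * m %| n)%N by rewrite /num_nodes expnS -mulnA dvdn_mull.
  have eq_mod (v v' : node) : col v = col v' -> (v %/ m %% N = v' %/ m %% N)%N ->
      (v = v' %[mod N * m])%N.
    move=> /(congr1 val)/= eq_col eq_row.
    rewrite (divn_eq (v %% _) m) (divn_eq (v' %% _) m) -!modn_divl eq_row.
    by rewrite !modn_dvdm ?dvdn_mull // eq_col.
  have := eq_mod _ _ _ (congr1 val eq_psi); rewrite !col_digit_word => /(_ erefl)/eqP.
  rewrite -eqz_nat -!modz_nat !dest_digit_word !ring_shift_eqmod // eqz_modDl.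
  rewrite eqz_mod_dvd -mulrBr PoszM [N%:Z * _]mulrC dvdz_mul2l // opprD addrACA subrr addr0.
  by rewrite opprD addrACA subrr add0r -eqz_mod_dvd !modz_nat eqz_nat => /eqP.
have psi_surj z : z \in [seq psi g | g in T].
  have eq_N : #|[seq psi g | g in T]| = #|'I_N|.
    by rewrite card_in_image // card_digit_eq card_ord.
  by have -> : [seq psi g | g in T] =i 'I_N by apply/(subset_cardP eq_N)/subsetP.
transitivity #|[pred g | (g \in T) && (psi g < s)%N]|.
  rewrite -!sum1_card [LHS]big_mkcond [RHS]big_mkcond /=.
  transitivity (\sum_(v | col v == col w)
      (((v %/ m) %% N < s) && (dig w v 0%R == zero_digit)))%N.
    rewrite [RHS]big_mkcond; apply: eq_bigr => v _; rewrite inE /short /special col_u eqxx col_w.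
    by case: (col v == 0) => //=; case: ifP.
  by rewrite sum_col_dig; apply: eq_bigr => g _; rewrite dest_dig inE andbC; case: ifP.
rewrite -(card_in_image (f := psi)) => [|g g' /andP[Tg _] /andP[Tg' _]]; last exact: psi_inj.
rewrite (eq_card (B := [pred z : 'I_N | z < s]%N)) => [|z].
  by rewrite -sum1_card (big_ord_narrow s_le) sum1_card card_ord.
rewrite !inE; apply/imageP/idP => [[g /andP[_ lt_s] -> //]|lt_s].
by have /imageP[g Tg def_z] := psi_surj z; exists g; rewrite // inE Tg -def_z.
Qed.

(** Each loop meets every column once. Idle loops start in all m columns, the other loops only in
    column 1, with s targets per source. *)
Lemma sum_loop e :
  (\sum_u \sum_v count_mem e (walk u (loop u v)) =
     m * (still (Some down_digit) (col e.1) == e.2) + s * (still None (col e.1) == e.2))%N.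
Proof.
have sum_still a c : (\sum_(u | col u == c) count_mem e (walk u (colword (still a) c m)) =
    (still a (col e.1) == e.2))%N.
  by rewrite sum_walk visits_colword // ltn_ord.
rewrite (eq_bigr (fun u => count_mem e (walk u (colword (still (Some down_digit)) (col u) m)) +
    (if (0 < p)%N && (col u == inZp 1)
     then s * count_mem e (walk u (colword (still None) (inZp 1) m)) else 0))%N) => [|u _].
  rewrite big_split /=; congr addn.
    rewrite (sum_by_col (fun c u => count_mem e (walk u (colword _ c m)))).
    rewrite (eq_bigr _ (fun c _ => sum_still _ c)).
    by rewrite sum_nat_const card_ord.
  rewrite -big_mkcond /=; have [p_gt0|p_0] := ltnP 0 p; last first.
    by rewrite big_pred0 //; case: s s_gt0 p_0 => // ? /(_ isT); lia.
  by rewrite -big_distrr sum_still.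
rewrite (bigD1 u) //= {1}/loop eqxx; congr addn.
rewrite (eq_bigr (fun v => if short u v
  then count_mem e (walk u (colword (still None) (col u) m)) else 0%N)); last first.
  by move=> v; rewrite /loop eq_sym => /negbTE->; case: ifP.
rewrite -big_mkcondr /=.
rewrite (eq_bigl (short u)) => [|v]; last first.
  rewrite andbC; case short_uv: (short u v) => //=.
  have /and3P[spec_v /eqP col_u _] := short_uv; have p_gt0 := special_gt0 spec_v.
  apply/eqP => v_u; move: spec_v; rewrite v_u /special col_u -val_eqE /=.
  by rewrite modn_small.
case: ifP => [/andP[p_gt0 /eqP col_u]|no].
  by rewrite sum_nat_const card_short // col_u.
rewrite big_pred0 // => v; apply: contraFF no => short_uv.
have /and3P[spec_v -> _] := short_uv; by rewrite (special_gt0 spec_v).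
Qed.

Lemma sum_shortcut e :
  (\sum_u \sum_v count_mem e (walk u (shortcut u v)) +
     (m * (still (Some down_digit) (col e.1) == e.2) + s * (still None (col e.1) == e.2)) =
   \sum_c \sum_v (((col e.1 - c)%R < (col v - c)%R) && (f (col e.1) c v == e.2)) +
     m * (if e.2 is Some _ then m * b ^ p else 0))%N.
Proof.
rewrite -sum_full -sum_loop -big_split; apply: eq_bigr => u _; rewrite -big_split.
apply: eq_bigr => v _.
by rewrite full_shortcut walk_cat count_cat dest_loop addnC.
Qed.

(** The row of a special node has a residue below s modulo b^p and a quotient below b. *)
Lemma card_special : (#|[pred v | special v]| <= s * b)%N.
Proof.
case: (posnP s) => [s0|s_pos].
  by rewrite eq_card0 // => v; rewrite !inE /special s0 andbF.
pose N := (b ^ p)%N.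
have lt_hi v : (v %/ m %/ N < b)%N.
  rewrite -divnMA ltn_divLR ?muln_gt0 ?expn_gt0 // mulnCA /N -expnS mulnC.
  exact: ltn_ord.
have N_gt0 : (0 < N)%N by rewrite expn_gt0.
pose row v : 'I_s * 'I_b := (insubd (Ordinal s_pos) (v %/ m %% N)%N, Ordinal (lt_hi v)).
rewrite -[s in (s * _)%N]card_ord -[b in (_ * b)%N]card_ord -card_prod.
rewrite -(card_in_image (f := row)); first exact: max_card.
move=> v v' /andP[/eqP col_v lt_v] /andP[/eqP col_v' lt_v'] [].
move=> /(congr1 val); rewrite !val_insubd lt_v lt_v' => eq_lo eq_hi.
apply/val_inj; rewrite /= (divn_eq v m) (divn_eq v' m) (divn_eq (v %/ m) N) (divn_eq (v' %/ m) N).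
rewrite eq_lo eq_hi; congr addn.
by have := congr1 val (etrans col_v (esym col_v')).
Qed.
End Shortcuts.

(** * Load levelling in the general case *)

Lemma card_slots d :
  #|[set x : 'I_m * node | ((d - x.1)%R < (col x.2 - x.1)%R)%N]| = ('C(m, 2) * b ^ m)%N.
Proof.
rewrite -sum1dep_card big_mkcond -(pair_bigA _ (fun c v =>
  if ((d - c)%R < (col v - c)%R)%N then 1%N else 0%N)) /=.
(* With j = d - c and r = col v - c the condition is j < r < m: C(m, 2) choices, each with b^m
   targets. *)
rewrite (eq_bigr (fun c : 'I_m => \sum_(r < m) ((d - c)%R < r) * b ^ m)%N) => [|c _].
  rewrite (reindex (fun j => d - j)); last by exists (fun j => d - j) => j _; rewrite subKr.
  rewrite exchange_big -bin2_sum big_mkord big_distrl; apply: eq_bigr => r _.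
  rewrite -big_distrl; congr muln.
  rewrite (eq_bigr (fun j : 'I_m => if (j < r)%N then 1%N else 0%N)) => [|j _].
    by rewrite -big_mkcond (big_ord_narrow (ltnW (ltn_ord r))) sum1_card card_ord.
  by rewrite subKr; case: ltnP.
rewrite (sum_by_col (fun c' _ => if ((d - c)%R < (c' - c)%R)%N then 1%N else 0%N)).
rewrite [RHS](reindex (fun c' => c' - c)) /=; last first.
  by exists (fun r => r + c) => r _; rewrite ?subrK ?addrK.
apply: eq_bigr => c' _; rewrite sum_nat_const card_col mulnC.
by case: ltnP.
Qed.

Lemma edge_ex : exists e : link, is_edge e.
Proof.
have lt0n : (0 < n)%N := num_nodes_gt0.
exists (Ordinal lt0n, Some zero_digit); rewrite /is_edge eq_sym.
apply/ring_shiftP; rewrite offsetE off_zero.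
rewrite addrC !modz_nat mod0n modn_small //=.
apply: leq_trans (_ : b ^ m <= _)%N; last exact: leq_pmulr.
by rewrite expnS; apply: leq_trans (leq_pmulr _ _); rewrite ?expn_gt0 //; lia.
Qed.

Lemma size_shortcut_max (s : nat) f u v : col u = 0 -> col v = ord_max -> u != v ->
  (0 < s -> 0 < p)%N ->  size (shortcut s f u v) = (m + p)%N.
Proof.
move=> col_u col_v ne_uv s_gt0; rewrite /shortcut (negbTE ne_uv) ifN.
  by rewrite size_full col_u col_v subr0.
apply/negP => short_uv; have /and3P[/andP[/eqP v0 lt_s] _ _] := short_uv.
have /s_gt0 : (0 < s)%N by apply: leq_ltn_trans lt_s.
by move/eqP: v0; rewrite col_v -val_eqE /=; case: p.
Qed.

(** The equation says that [L] and [s] are quotient and remainder of the load of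
    a column, [m] being subtracted for the routes from a node to itself. *)
Lemma general_routing (L s : nat) : (0 < p)%N -> (s <= b ^ p)%N ->
    (b.+1 * L + s + m = 'C(m, 2) * b ^ m + m ^ 2 * b ^ m)%N ->
    (m ^ 2 * b ^ p <= L)%N -> (s * b <= L + s)%N ->
    ((1 < p) ==> (s * b + m ^ 2 * b ^ p <= L + m + s))%N ->
  exists R : node -> node -> seq link,
    [/\ routing_strategy R,
        worst_hops R = (2 * m - 1)%N,
        avg_hops R <= 3%:R / 2%:R * m%:R
      & congestion_free R].
Proof.
move=> p_gt0 s_le eq_L le_L le_sL le_sbL.
(* [M] is the load of the digit words; [q] is what the extra hops in column d must add to give L
   once the loops are cut. *)
pose M a := (if a is Some _ then m ^ 2 * b ^ p else 0)%N.
pose q d a := (L + m * (still (Some down_digit) d == a) + s * (still None d == a) - M a)%N.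
(* [D d] holds the pairs (source column, target) whose extra hops cross column d, [V d] those whose
   label is prescribed by the shortcuts. *)
pose D d := [set x : 'I_m * node | ((d - x.1)%R < (col x.2 - x.1)%R)%N].
pose V d := [set x : 'I_m * node | [&& d != 0, x.1 == inZp 1 & special s x.2]].
have le_M a : (M a <= L)%N by case: a.
have alloc d : exists h : 'I_m * node -> label, {in V d, forall x, h x = still None d} /\
    forall a, #|[set x in D d | h x == a]| = q d a.
  apply: allocation_with.
  - apply/subsetP => -[c v]; rewrite !inE [(_, _).1]/= [(_, _).2]/=.
    move=> /and3P[d_n0 /eqP -> /andP[/eqP col_v _]]; rewrite col_v !val_subc1.
    rewrite inZp0 eqxx (negbTE d_n0).
    by case: d d_n0 => -[|d] //= lt_d; rewrite ltnS in lt_d; case/negP; exact/eqP/val_inj.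
  - have [->|d_n0] := eqVneq d 0.
      rewrite (_ : V 0 = set0) ?cards0 //; apply/setP => x; by rewrite !inE eqxx.
    apply: (@leq_trans (s * b)).
      apply: leq_trans (card_special s).
      rewrite -(cardsE (special s)) -[leqRHS]mul1n -(cards1 (inZp 1 : 'I_m)) -cardsX.
      by apply/subset_leq_card/subsetP => -[c v]; rewrite !inE => /and3P[_ -> ?].
    (* The prescribed label is [None] in the last column and the zero digit before it; a column
       other than 0 and the last needs p > 1. *)
    rewrite /q /still; have [_|d_max] := eqVneq d ord_max.
      by rewrite eqxx /= muln0 addn0 muln1 subn0.
    rewrite eqxx !muln1 leq_subRL; last by rewrite -addnA (leq_trans le_L) ?leq_addr.
    rewrite addnC; apply: (implyP le_sbL).
    case: d d_n0 d_max => -[|d] lt_d; rewrite -!val_eqE //= => _ ne_p.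
    by move: lt_d; rewrite ltnS leq_eqVlt (negbTE ne_p) /= => /(leq_trans _)->.
  - rewrite card_slots; have sum1 (a : label) : (\sum_c (a == c) = 1)%N.
      by rewrite (bigD1 a) //= eqxx big1 // => c; rewrite eq_sym => /negbTE->.
    apply: (@addIn (\sum_a M a)); rewrite -big_split /=.
    rewrite (eq_bigr (fun a => L + m * (still (Some down_digit) d == a)
                                 + s * (still None d == a)))%N => [|a _]; last first.
      by rewrite subnK // (leq_trans (le_M a)) // -addnA leq_addr.
    rewrite !big_split /= -!big_distrr /= !sum1 !muln1 sum_nat_const card_option card_ord.
    rewrite [in RHS](bigD1 None) //= (eq_bigr (fun=> m ^ 2 * b ^ p))%N => [|[i|] //].
    rewrite sum_nat_const cardC1 card_option card_ord /=.
    by rewrite add0r mulnCA -expnS -eq_L addnAC add1n.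
have [h hP] := fin_all_exists alloc.
pose f d c v := h d (c, v).
have f_special v d : special s v -> d != 0 -> f d (inZp 1) v = still None d.
  by move=> spec_v d_n0; apply: (hP d).1; rewrite !inE d_n0 eqxx.
have s_gt0 : (0 < s -> 0 < p)%N by [].
apply: (@balanced_routing (shortcut s f) L).
- by rewrite (leq_trans _ le_L) // muln_gt0 !expn_gt0.
- exact: dest_shortcut.
- by move=> u; rewrite /shortcut eqxx.
- exact: size_shortcut.
- have [u col_u] := col_ex 0; have [v col_v] := col_ex ord_max; exists u, v.
  apply: size_shortcut_max => //; apply/eqP => e_uv; move: col_u; rewrite e_uv col_v.
  by move/(congr1 val) => /= p0; rewrite p0 in p_gt0.
- move=> e _; have := sum_shortcut s_gt0 s_le f_special e.
  have -> : (\sum_c \sum_v (((col e.1 - c)%R < (col v - c)%R) && (f (col e.1) c v == e.2)) =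
      q (col e.1) e.2)%N.
    rewrite pair_bigA -(hP (col e.1)).2 -sum1dep_card [RHS]big_mkcond.
    by apply: eq_bigr => -[c v] _; rewrite inE; case: ifP.
  have -> : (m * (if e.2 is Some _ then m * b ^ p else 0) = M e.2)%N.
    by rewrite /M; case: e.2 => [_|]; rewrite ?muln0 // mulnA.
  by rewrite /q; move: (le_M e.2); lia.
- exact: edge_ex.
Qed.

(** * Routes tabulated by source column and distance *)

Section Plans.
Variables (cls : pred 'I_m) (body : 'I_m -> nat -> seq label).

Definition gap u v : nat := ((v + (n - u)) %% n)%N.

Lemma gap_lt u v : (gap u v < n)%N.
Proof. by rewrite ltn_mod num_nodes_gt0. Qed.

Lemma gap_eqmod u v : ((gap u v)%:Z = v%:Z - u%:Z %[mod n])%Z.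
Proof.
rewrite -modz_nat modz_mod PoszD -subzn; last exact/ltnW/ltn_ord.
by rewrite addrCA modzDl.
Qed.

Lemma ring_shift_gap u v (x : int) : (x = gap u v %[mod n])%Z -> ring_shift u x = v.
Proof.
move=> def_x; apply/eqP/ring_shiftP.
by rewrite -modzDmr def_x gap_eqmod modzDmr addrC subrK.
Qed.

Lemma gap_shift u (D : 'I_n) : gap u (ring_shift u D) = D.
Proof.
apply/eqP; rewrite -eqz_nat -[X in X == _](@modz_small _ n%:Z) ?ltz_nat ?gap_lt //.
rewrite gap_eqmod -modzDml ring_shiftE modz_mod modzDml [_ + D%:Z]addrC addrK modz_small //.
by rewrite ltz_nat ltn_ord.
Qed.

Lemma gap_col u v : inZp (gap u v) = col v - col u.
Proof.
apply: (addIr (col u)); rewrite subrK addrC -[v in RHS](@ring_shift_gap u v (gap u v)) //.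
move: (gap u v) => D; apply/val_inj/eqP; rewrite -eqz_nat /= modnDm -!modz_nat; apply/eqP.
by rewrite ring_shift_eqmod ?dvdn_m // PoszD.
Qed.

Definition slotted c D := cls c && (inZp D == inZp 1 :> 'I_m).

(** Routes depend only on the column of the source and on the distance, except
    that for columns in [cls] and targets in the next column the first label is
    given by [f], which is then used to level the loads in that column. *)
Definition plan (f : 'I_m -> node -> label) u v : seq label :=
  if u == v then [::]
  else if slotted (col u) (gap u v) then
    let a := f (col u) v in
    let w := target (u, a) in a :: body (col w) (gap w v)
  else body (col u) (gap u v).

Definition cols : seq 'I_m := [seq inZp i | i <- iota 0 m].
Definition labels : seq label := None :: [seq Some (inZp i) | i <- iota 0 b].

Definition body_ok c D :=
  (disp c (body c D) == D%:Z %[mod n])%Z && (size (body c D) <= m + D %% m)%N.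

(** The load on label [a] in column [d] apart from the labels given by [f].  It is
    computed on sequences because [bigop] does not reduce. *)
Definition rest d a : nat := (sumn [seq
    sumn [seq visits c (body c D) d a | D <- iota 0 n & (D != 0) && ~~ slotted c D] +
    (if cls c then sumn [seq visits (c + inZp 1)%R (body (c + inZp 1)%R D) d a |
                          D <- iota 0 n & inZp D == 0%R :> 'I_m] else 0) | c <- cols])%N.

(** The last check says that [f] supplies exactly what is missing: b^m labels in a column of [cls],
    one per target in the next column, and none elsewhere. *)
Definition plan_ok (L : nat) :=
  all (fun c => [&& all (fun D => slotted c D || body_ok c D) (iota 0 n),
                    all (fun a => rest c a <= L)%N labels
                  & sumn [seq L - rest c a | a <- labels]%N == if cls c then b ^ m else 0]%N) cols.

Lemma sum_cols (F : 'I_m -> nat) : sumn [seq F c | c <- cols] = (\sum_c F c)%N.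
Proof.
rewrite sumnE -map_comp big_map -[iota 0 m]/(index_iota 0 m) big_mkord.
by apply: eq_bigr => c _; rewrite /= inZp_val.
Qed.

Lemma sum_labels (F : label -> nat) : sumn [seq F a | a <- labels] = (\sum_a F a)%N.
Proof.
transitivity (F None + sumn [seq F (Some (inZp i)) | i <- iota 0 b])%N.
  by rewrite /labels map_cons -map_comp.
rewrite (bigD1 None isT) sumnE big_map -[iota 0 b]/(index_iota 0 b) big_mkord; congr addn.
rewrite [RHS](reindex_omap Some id) => [|[]//].
apply: eq_big => [i|i _]; first by rewrite /= eqxx.
by congr (F (Some _)); apply: val_inj; rewrite /= modn_small.
Qed.

Lemma sum_iota (P : pred nat) (F : nat -> nat) :
  sumn [seq F D | D <- iota 0 n & P D] = (\sum_(D < n | P D) F D)%N.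
Proof. by rewrite sumnE big_map big_filter -[X in iota 0 X]subn0 -/(index_iota 0 n) big_mkord. Qed.

Lemma sum_gap u (P : pred nat) (F : nat -> nat) :
  (\sum_(v | P (gap u v)) F (gap u v) = \sum_(D < n | P D) F D)%N.
Proof.
rewrite (reindex (fun D : 'I_n => ring_shift u D)) /=.
  by apply: eq_big => [D|D _]; rewrite gap_shift.
exists (fun v => Ordinal (gap_lt u v)) => [D _|v _]; last exact: ring_shift_gap.
by apply: val_inj; rewrite /= gap_shift.
Qed.

Lemma gap_eq0 u v : (gap u v == 0)%N = (u == v).
Proof.
apply/eqP/eqP => [gap0|->].
  by rewrite -(@ring_shift_gap u v 0) ?gap0 ?ring_shift0.
by rewrite /gap subnKC ?modnn // ltnW.
Qed.

Lemma slotted_gap u v : slotted (col u) (gap u v) = cls (col u) && (col v == col u + inZp 1).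
Proof. by rewrite /slotted gap_col subr_eq [inZp 1 + _]addrC. Qed.

(** For a fixed target, the first hop translates the source column onto the next one, so the
    continuations run through all distances divisible by m; [rest] includes them. *)
Lemma sum_plan f e : (0 < p)%N ->
  (\sum_u \sum_v count_mem e (walk u (plan f u v)) =
     rest (col e.1) e.2 +
     (if cls (col e.1) then
        #|[set v | (col v == (col e.1 + inZp 1)%R) && (f (col e.1) v == e.2)]| else 0))%N.
Proof.
move=> p_gt0.
pose G v w := count_mem e (walk w (body (col w) (gap w v))).
rewrite (eq_bigr (fun u =>
    \sum_(v | (gap u v != 0) && ~~ slotted (col u) (gap u v)) 
       count_mem e (walk u (body (col u) (gap u v))) +
    \sum_(v | cls (col u) && (col v == (col u + inZp 1)%R))
       (count_mem e (walk u [:: f (col u) v]) + G v (target (u, f (col u) v)))))%N; last first.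
  move=> u _; rewrite [X in _ = (X + _)%N]big_mkcond [X in _ = (_ + X)%N]big_mkcond -big_split /=.
  apply: eq_bigr => v _; rewrite gap_eq0 -slotted_gap /plan.
  case: eqVneq => [<-|_] /=; last by case: ifP => _; rewrite /G /=; lia.
  rewrite slotted_gap -{2}[col u]addc0 (inj_eq (addrI _)) inZp0 -val_eqE /= modn_small //.
  by rewrite andbF.
rewrite big_split /= /rest sum_cols big_split /= -addnA; congr addn.
  rewrite (eq_bigr (fun u => \sum_(D < n | (D != 0%N :> nat) && ~~ slotted (col u) D)
      count_mem e (walk u (body (col u) D))))%N => [|u _]; last first.
    exact: (sum_gap u (fun D => (D != 0%N) && ~~ slotted (col u) D)
              (fun D => count_mem e (walk u (body (col u) D)))).
  rewrite (sum_by_col (fun c u => \sum_(D < n | (D != 0%N :> nat) && ~~ slotted c D)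
      count_mem e (walk u (body c D)))%N).
  apply: eq_bigr => c _; rewrite sum_iota exchange_big.
  by apply: eq_bigr => D _; rewrite sum_walk.
rewrite (sum_by_col (fun c u => \sum_(v | cls c && (col v == (c + inZp 1)%R))
    (count_mem e (walk u [:: f c v]) + G v (target (u, f c v))))%N).
pose slots c := #|[set v | (col v == c + inZp 1) && (f c v == e.2)]|.
transitivity (\sum_c ((if cls c then sumn
    [seq visits (c + inZp 1)%R (body (c + inZp 1)%R D) (col e.1) e.2 | D <- iota 0 n &
       inZp D == 0%R :> 'I_m] else 0) +
    (if c == col e.1 then if cls c then slots c else 0 else 0)))%N.
  apply: eq_bigr => c _; case: (cls c); last first.
    by rewrite big1 ?if_same // => u _; rewrite big_pred0.
  rewrite exchange_big /=.
  under eq_bigr => v _ do rewrite big_split /= sum_target.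
  rewrite big_split addnC; congr addn.
    transitivity (\sum_(v | col v == (c + inZp 1)%R) ((c == col e.1) && (f c v == e.2)))%N.
      by apply: eq_bigr => v _; have := sum_walk c [:: f c v] e; rewrite /= addn0.
    case: eqP => _; last by rewrite big1.
    by rewrite /slots -sum1dep_card big_mkcondr; apply: eq_bigr => v _; case: eqP.
  rewrite exchange_big sum_iota.
  transitivity (\sum_(w | col w == (c + inZp 1)%R)
      \sum_(D < n | inZp D == 0%R :> 'I_m) count_mem e (walk w (body (c + inZp 1)%R D)))%N.
    apply: eq_bigr => w /eqP col_w.
    rewrite -(sum_gap w (fun D => inZp D == 0%R :> 'I_m)
      (fun D => count_mem e (walk w (body (c + inZp 1)%R D)))).
    by apply: eq_big => [v|v _]; rewrite ?gap_col -?col_w ?subr_eq0 // /G.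
  by rewrite exchange_big; apply: eq_bigr => D _; rewrite sum_walk.
rewrite big_split; congr addn; rewrite -big_mkcond big_pred1_eq.
by case: ifP.
Qed.

(** The deficits [L - rest c a] are the quotas from which [allocation] builds [f]; the distance D
    provides a route of 2m - 1 hops. *)
Lemma plan_routing L : (0 < p)%N -> (0 < L)%N -> plan_ok L ->
    (exists2 D, D < n & ~~ slotted 0%R D && (size (body 0%R D) == m + p))%N ->
  exists R : node -> node -> seq link,
    [/\ routing_strategy R,
        worst_hops R = (2 * m - 1)%N,
        avg_hops R <= 3%:R / 2%:R * m%:R
      & congestion_free R].
Proof.
move=> p_gt0 L_gt0 ok [D0 lt_D0 /andP[D0_slot /eqP size0]].
have cols_c c : c \in cols.
  by apply/mapP; exists (c : nat); rewrite ?inZp_val // mem_iota /=.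
have labels_a a : a \in labels.
  case: a => [i|]; rewrite inE //; apply/orP; right; apply/mapP; exists (i : nat).
    by rewrite mem_iota /=.
  by congr Some; apply: val_inj; rewrite /= modn_small.
have body_okP c D : (D < n)%N -> ~~ slotted c D -> body_ok c D.
  move=> lt_D /negbTE nslot; have /and3P[/allP/(_ D) + _ _] := allP ok c (cols_c c).
  by rewrite mem_iota nslot; apply.
have rest_le c a : (rest c a <= L)%N.
  by have /and3P[_ /allP/(_ a (labels_a a)) + _] := allP ok c (cols_c c).
have rest_sum c : (\sum_a (L - rest c a) = if cls c then b ^ m else 0)%N.
  by have /and3P[_ _ /eqP <-] := allP ok c (cols_c c); rewrite sum_labels.
have alloc c : exists h : node -> label, cls c ->
    forall a, #|[set v in [set v | col v == c + inZp 1] | h v == a]| = (L - rest c a)%N.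
  case cls_c: (cls c); last by exists (fun=> None).
  have [|h hP] := @allocation _ _ [set v | col v == c + inZp 1] (fun a => L - rest c a)%N None.
    by rewrite rest_sum cls_c cardsE card_col.
  by exists h.
have [f fP] := fin_all_exists alloc.
have inZp1_n0 : inZp 1 != 0 :> 'I_m by rewrite -val_eqE /= modn_small.
have gap_mod u v : (gap u v %% m)%N = (col v - col u)%R :> nat.
  exact: (congr1 (@nat_of_ord m) (gap_col u v)).
have body_gap u v : ~~ slotted (col u) (gap u v) ->
    dest u (body (col u) (gap u v)) = v /\
    (size (body (col u) (gap u v)) <= m + (col v - col u)%R)%N.
  move=> /(body_okP _ _ (gap_lt u v))/andP[/eqP ok_disp size_le]; rewrite -gap_mod; split=> //.
  by rewrite dest_shift (@ring_shift_gap u v _ ok_disp).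
have slot_next u v a : slotted (col u) (gap u v) ->
    col v = col (target (u, a)) /\
    ~~ slotted (col (target (u, a))) (gap (target (u, a)) v).
  rewrite !slotted_gap col_target => /andP[_ /eqP ->]; split=> //.
  by rewrite -[X in X == _]addr0 (inj_eq (addrI _)) eq_sym (negbTE inZp1_n0) andbF.
apply: (@balanced_routing (plan f) L) => //.
- move=> u v; rewrite /plan; case: eqVneq => [//|_]; case: ifPn => [slot|/body_gap[]//].
  by have [_ /body_gap[]] := slot_next u v (f (col u) v) slot.
- by move=> u; rewrite /plan eqxx.
- move=> u v; rewrite /plan; case: eqVneq => [//|_]; case: ifPn => [slot|/body_gap[]//].
  have [col_v /body_gap[_]] := slot_next u v (f (col u) v) slot.
  rewrite -col_v subrr addn0 => le_m.
  have -> : col v - col u = inZp 1 by rewrite col_v col_target [col u + _]addrC addrK.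
  have -> : (inZp 1 : 'I_m) = 1%N :> nat by apply: modn_small.
  by rewrite addn1; apply: le_m.
- have [u col_u] := col_ex 0; exists u, (ring_shift u (Ordinal lt_D0)).
  rewrite /plan -gap_eq0 !gap_shift /= !col_u ifN ?ifN //.
  have /andP[_] := body_okP _ _ lt_D0 D0_slot; rewrite size0 leq_add2l.
  by apply: contraL => /eqP ->; rewrite mod0n -ltnNge.
- move=> e _; rewrite sum_plan //; case: ifP => cls_e.
    rewrite -(subnKC (rest_le (col e.1) e.2)) -fP //; congr addn.
    by apply: eq_card => v; rewrite !inE.
  (* A zero total of deficits forces each of them to vanish. *)
  have /eqP := rest_sum (col e.1); rewrite cls_e sum_nat_eq0 => /forallP/(_ e.2).
  by rewrite subn_eq0 addn0 => le_L; apply/eqP; rewrite eqn_leq rest_le.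
- exact: edge_ex.
Qed.
End Plans.
End Walks.

(** * Route tables for k = 1 and m = 2, 3 *)

Section ExceptionalTables.
Variable p : nat.
Local Notation b := 3.
Local Notation m := p.+1.
Local Open Scope nat_scope.

(** The number 3 encodes the label [None]. *)
Definition decode (x : nat) : label 1 := if x == 3 then None else Some (inZp x).

(** By default the extra hops use [None]. *)
Definition table_word (overrides : seq ((nat * nat) * seq nat)) (c : 'I_m) (D : nat) :
    seq (label 1) :=
  let r := D %% m in
  (* Modulo b^m this is D %/ m + r - 1 + [offset_val]: each of the r hops by [None] loses m besides
     its unit step. *)
  let t := (D %/ m + r + (b ^ m)./2 + (b ^ m).-1) %% b ^ m in
  let default := nseq r 3 ++
    [seq t %/ b ^ (p - (c + r + j) %% m) %% b | j <- iota 0 m] in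
  map decode (last default [seq x.2 | x <- overrides & x.1 == (c : nat, D)]).

End ExceptionalTables.

(** Found by computer search: distance classes (column of the source, distance)
    rerouted so that no load exceeds 10 for m = 2 and 80 for m = 3. *)
Definition overrides2 :=
  [:: ((0, 0), [::]); ((0, 1), [:: 1]); ((0, 5), [:: 1; 2; 1]); ((0, 7), [:: 0; 3; 0]);
      ((0, 15), [:: 3; 0; 3]); ((0, 16), [:: 3; 0]); ((0, 17), [:: 3]);
      ((1, 16), [:: 3; 3])]%N.

Definition overrides3 :=
  [:: ((0, 0), [::]); ((0, 14), [:: 1; 1; 1; 1; 2]); ((0, 69), [:: 3; 0; 0]);
      ((0, 75), [:: 3; 3; 0])]%N.

(** The targets 10 and 80 are the quotients in 43 = 4 * 10 + 3 for m = 2 and 321 = 4 * 80 + 1 for m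
    = 3; full routes would load the digit labels with 12 and 81. *)
Lemma plan2_ok : plan_ok (pred1 (inZp 1)) (@table_word 1 overrides2) 10.
Proof. by vm_compute. Qed.

Lemma plan3_ok : plan_ok predT (@table_word 2 overrides3) 80.
Proof. by vm_compute. Qed.

(** With one column there are no extra hops, and each digit is a route of one link. The digit -1 and
    [None] label self-loops, which are not edges, so every edge carries load 1. *)
Lemma single_column_routing k : (0 < k)%N ->
  exists R : 'I_(num_nodes k 1) -> 'I_(num_nodes k 1) -> seq (link k 1),
    [/\ routing_strategy R,
        worst_hops R = (2 * 1 - 1)%N,
        avg_hops R <= 3%:R / 2%:R * 1%:R
      & congestion_free R].
Proof.
move=> k_gt0; pose f (d c : 'I_1) (v : 'I_(num_nodes k 1)) : label k := None.
have no_special v d : special 0 v -> d != 0 -> f d (inZp 1) v = still None d.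
  by rewrite (ord1 d).
apply: (@balanced_routing k 0 (shortcut 0 f) 1%N) => //.
- exact: dest_shortcut.
- by move=> u; rewrite /shortcut eqxx.
- exact: size_shortcut.
- have n_gt1 : (1 < num_nodes k 1)%N by rewrite /num_nodes muln1 expn1; lia.
  exists (Ordinal (ltnW n_gt1)), (Ordinal n_gt1).
  by apply: size_shortcut_max => //; rewrite !ord1.
- have no_slot (x y : 'I_1) : (x < y)%N = false by rewrite !ord1.
  case=> u a edge_e.
  have not_still x : off (ord_max : 'I_1) x = 1 - 1%:Z -> (still x (col u) == a) = false.
    move=> off_x; have := dest_still k_gt0 u off_x; rewrite /colword /= addc0 => stay.
    by apply: contraNF edge_e => /eqP <-; rewrite eq_sym; apply/eqP.
  have := sum_shortcut (s := 0) k_gt0 (fun s_gt0 => s_gt0) (leq0n _) no_special (u, a).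
  rewrite [X in _ = (X + _)%N]big1 => [|c _]; last first.
    by rewrite big1 // => v _; rewrite no_slot.
  rewrite !not_still ?off_down ?off_none //.
  case: a edge_e not_still => [i|] _ not_still; first by rewrite expn0 /= muln0 !addn0 !muln1.
  by have := not_still None (off_none k 0); rewrite /still !ord1 eqxx.
- exact: edge_ex.
Qed.

(** The digit labels fit below the average load once p b > 2 m, by [slack]; for k = 1 this means p >
    2, and for k > 1 it always holds. *)
Lemma routing_arithmetic k p (b := (2 * k).+1) (m := p.+1)
    (P := ('C(m, 2) * b ^ m + m ^ 2 * b ^ m - m)%N) (L := (P %/ b.+1)%N) (s := (P %% b.+1)%N) :
    (0 < k)%N -> (0 < p)%N -> (k, p) != (1, 1)%N -> (k, p) != (1, 2)%N ->
  [/\ (s <= b ^ p)%N,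
      (b.+1 * L + s + m = 'C(m, 2) * b ^ m + m ^ 2 * b ^ m)%N,
      (m ^ 2 * b ^ p <= L)%N, (s * b <= L + s)%N
    & ((1 < p) ==> (s * b + m ^ 2 * b ^ p <= L + m + s))%N].
Proof.
move=> k_gt0 p_gt0 ne1 ne2.
have b_ge3 : (3 <= b)%N by rewrite /b; lia.
have B_gt0 : (0 < b ^ m)%N by rewrite expn_gt0.
have def_P : (P + m = 'C(m, 2) * b ^ m + m ^ 2 * b ^ m)%N by rewrite /P subnK //; nia.
have def_LS : (P = b.+1 * L + s)%N by rewrite {1}(divn_eq P b.+1) mulnC.
have s_le : (s <= b)%N by rewrite -ltnS ltn_mod.
have X_ge : (b <= b ^ p)%N by rewrite -{1}(expn1 b) leq_exp2l //; lia.
have P2 : (2 * (P + m) = m * p * (b * b ^ p) + 2 * (m ^ 2 * (b * b ^ p)))%N.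
  rewrite def_P -expnS mulnDr mulnA; congr (_ * _ + _)%N.
  by rewrite -mul_bin_diag bin1.
have pb_ge : (2 * m < p * b)%N.
  have [k2|p3] : (1 < k)%N \/ (2 < p)%N.
    by move: ne1 ne2 k_gt0 p_gt0; rewrite !xpair_eqE; case: (k) (p) => [|[|?]] [|[|[|?]]] //; auto.
  - have : (p * 2 <= p * k)%N by rewrite leq_mul2l k2 orbT.
    by rewrite /m /b; lia.
  - have : (p * 1 <= p * k)%N by rewrite leq_mul2l k_gt0 orbT.
    by rewrite /m /b; lia.
set X := (b ^ p)%N in X_ge P2 *.
have P2' : (2 * (P + m) = m * (p * b * X + 2 * m * (b * X)))%N by rewrite P2; ring.
have slack : (2 * (m ^ 2 * X * b.+1) + m * X * (p * b - 2 * m) = 2 * (P + m))%N.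
  have [d def_d] : exists d, (p * b = 2 * m + d)%N by exists (p * b - 2 * m)%N; lia.
  by rewrite P2' def_d addKn; ring.
(* Y is the room above the digit labels; the term 2 * m pays for the m subtracted in P. *)
have boundP Y : (2 * (Y * b.+1) + 2 * m <= m * X * (p * b - 2 * m))%N -> (m ^ 2 * X + Y <= L)%N.
  by move=> le_Y; rewrite leq_divRL // mulnDl; lia.
have mX_le : (2 * m <= m * X)%N by rewrite mulnC leq_mul2l; lia.
have pb_sub : (m * X * 1 <= m * X * (p * b - 2 * m))%N by rewrite leq_mul2l subn_gt0 pb_ge orbT.
have le_L : (m ^ 2 * X <= L)%N by rewrite -[leqLHS]addn0 boundP //; lia.
have eq_L : (b.+1 * L + s + m = 'C(m, 2) * b ^ m + m ^ 2 * b ^ m)%N by rewrite -def_LS.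
have le_sX : (s <= X)%N by apply: leq_trans X_ge.
have [p_gt1|p_le1] := ltnP 1 p.
  (* Room b (b - 1) suffices, since s <= b and s b = s (b - 1) + s. *)
  have bound : ((m ^ 2 * X + b * b.-1) <= L)%N.
    apply: boundP; have [p2|p_gt2] : p = 2 \/ (2 < p)%N by lia.
      have b_ge5 : (5 <= b)%N by move: pb_ge; rewrite p2 /m p2 /b; lia.
      rewrite /m /X p2; move: b_ge5; clear; move: b => c.
      case: c => [|[|[|[|[|c]]]]] // _.
      have -> : (2 * c.+4.+1 - 2 * 3 = 2 * c + 4)%N by lia.
      by rewrite /= !expnS expn0; nia.
    have X_ge3 : (b ^ 3 <= X)%N by rewrite leq_exp2l //; lia.
    have m_ge4 : (4 <= m)%N by [].
    have m_X : (m * b ^ 3 <= m * X)%N by rewrite leq_mul2l X_ge3 orbT.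
    have cube : (b * b.-1 * b.+1 + b = b ^ 3)%N by rewrite /b /=; ring.
    have : (4 * b ^ 3 <= m * b ^ 3)%N by rewrite leq_mul2r m_ge4 orbT.
    have : (m * 3 ^ 3 <= m * b ^ 3)%N by rewrite leq_mul2l leq_exp2r // b_ge3 orbT.
    by move: pb_sub m_X cube; rewrite muln1 (_ : 3 ^ 3 = 27)%N //; clear; lia.
  have le_sbb : (s * b.-1 <= b * b.-1)%N by rewrite leq_mul2r s_le orbT.
  have def_sb : (s * b = s * b.-1 + s)%N by rewrite -mulnSr.
  have m_le : (m <= m ^ 2 * X)%N by rewrite -mulnA leq_pmulr // muln_gt0; lia.
  split=> //; first by lia.
  by apply/implyP => _; lia.
have p1 : p = 1%N by apply/eqP; rewrite eqn_leq p_le1.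
split=> //.
have X_b : X = b by rewrite /X p1 expn1.
have b_ge5 : (5 <= b)%N by move: pb_ge; rewrite p1 /m p1 /b; lia.
move: P2' def_LS s_le b_ge5; rewrite X_b /m p1; clearbody s L P b; clear => P5 def_P s_le b_ge5.
(* Here P = 5 b^2 - 2 = (b + 1) (5 b - 5) + 3, whence also s <= 3. *)
have L_ge : (5 * b - 5 <= L)%N.
  rewrite leqNgt; apply/negP => lt_L.
  have : (b.+1 * L <= b.+1 * (5 * b - 6))%N by rewrite leq_mul2l /=; lia.
  rewrite mulnBr; nia.
have : (b.+1 * (5 * b - 5) <= b.+1 * L)%N by rewrite leq_mul2l L_ge.
rewrite mulnBr => le_L; have s_le3 : (s <= 3)%N by nia.
have : (s * b <= 3 * b)%N by rewrite leq_mul2r s_le3 orbT.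
lia.
Qed.

Theorem theorem6 (k m : nat) (hk : (1 <= k)%N) (hm : (1 <= m)%N) :
  exists R : 'I_(num_nodes k m) -> 'I_(num_nodes k m) -> seq (link k m),
    [/\ routing_strategy R,
        worst_hops R = (2 * m - 1)%N,
        avg_hops R <= 3%:R / 2%:R * m%:R
      & congestion_free R].
Proof.
case: m hm => // -[|p] _; first exact: single_column_routing.
have [[-> ->]|ne1] := eqVneq (k, p) (1, 0)%N.
  (* From column 0, distance 3 is neither slotted nor overridden and is 1 modulo 2, so its route has
     2 + 1 hops; likewise distance 5 for m = 3, with 3 + 2 hops. *)
  by apply: (plan_routing _ _ _ plan2_ok) => //; exists 3.
have [[-> ->]|ne2] := eqVneq (k, p) (1, 1)%N.
  by apply: (plan_routing _ _ _ plan3_ok) => //; exists 5.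
have [s_le eq_L le_L le_s le_sb] := @routing_arithmetic k p.+1 hk isT ne1 ne2.
exact: general_routing s_le eq_L le_L le_s le_sb.
Qed.
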